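(* The degree-2 representation $B:\mathcal{S}_3\to\mathrm{GL}(2,\mathbb{Z}_3)$ (reduced from the representation of $\mathcal{S}_3$ by $3\times3$ permutation matrices) given on generators by $$B(\sigma_1)=\begin{pmatrix}2&2\\0&1\end{pmatrix},\qquad B(\sigma_2)=\begin{pmatrix}1&0\\2&2\end{pmatrix}$$ is equivalent to the representation ${}_{(2,0,1)}\rho_2:\mathcal{S}_3\to\mathcal{R}_2(\mathbb{Z}_3)\subset\mathrm{GL}(2,\mathbb{Z}_3)$.
   Context: $\mathbb{Z}_3$ is the field of integers modulo $3$. $\mathcal{S}_3\cong\langle\sigma_1,\sigma_2\mid\sigma_1^2=\sigma_2^2=(\sigma_1\sigma_2)^3=1\rangle$, with $\sigma_1=(1\,2)$, $\sigma_2=(1\,3)$. The Riordan group $\mathcal{R}(\mathbb{Z}_3)$ is the set of pairs $(g(t),f(t))$ of formal power series over $\mathbb{Z}_3$ with $g(0)\neq0$, $f(0)=0$, $f'(0)\neq 0$, with operation $(g_1,f_1)*(g_2,f_2)=(g_1(t)g_2(f_1(t)),\,f_2(f_1(t)))$; the pair $(g,f)$ is identified with the infinite lower triangular matrix $(a_{n,k})_{n,k\ge0}$, $a_{n,k}=[t^n]g(t)f(t)^k$, the operation being matrix multiplication. Taking the first two rows and columns gives a group epimorphism $\pi_2$ from $\mathcal{R}(\mathbb{Z}_3)$ onto the group $\mathcal{R}_2(\mathbb{Z}_3)$ of invertible lower triangular $2\times2$ matrices over $\mathbb{Z}_3$. For $a\in\{1,2\}$, $b\in\mathbb{Z}_3$,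 $s\in\{1,2\}$, put $$r_1=\left(\frac{a}{(1+(b+1)t)^s},\frac{2t}{1+(b+1)t}\right),\qquad r_2=\left(\frac{a}{(1+bt)^s},\frac{2t}{1+bt}\right)\in\mathcal{R}(\mathbb{Z}_3).$$ Let ${}_{(a,b,s)}\rho:\mathcal{S}_3\to\mathcal{R}(\mathbb{Z}_3)$ be the homomorphism with $\sigma_1\mapsto r_2$, $\sigma_2\mapsto r_1$, and let ${}_{(a,b,s)}\rho_2=\pi_2\circ{}_{(a,b,s)}\rho$. For $(a,b,s)=(2,0,1)$ one has $\pi_2(r_1)=\begin{pmatrix}2&0\\2&1\end{pmatrix}$ and $\pi_2(r_2)=\begin{pmatrix}2&0\\0&1\end{pmatrix}$. Two representations $\varphi,\psi:G\to\mathrm{GL}(2,\mathbb{Z}_3)$ are equivalent if there is $T\in\mathrm{GL}(2,\mathbb{Z}_3)$ with $\varphi(g)=T\psi(g)T^{-1}$ for all $g\in G$. *)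

(* Defs.v *)
From HB Require Import structures.
From mathcomp Require Import all_boot all_order all_algebra all_fingroup.
From mathcomp Require Import boolp zify.

Set Implicit Arguments.
Unset Strict Implicit.
Unset Printing Implicit Defensive.

Import GRing.Theory.
Local Open Scope ring_scope.

Record fps (K : Type) := Fps { fps_coef :> nat -> K }.

HB.instance Definition _ (K : Type) := gen_eqMixin (fps K).
HB.instance Definition _ (K : Type) := gen_choiceMixin (fps K).

Lemma fps_eqP (K : Type) (p q : fps K) : (forall n, p n = q n) -> p = q.
Proof. by case: p q => [p] [q] /= /funext ->. Qed.

Section FpsRing.
Variable K : fieldType.
Implicit Types (p q r f g h : fps K) (P Q F G : {poly K}) (N : nat).

Definition fpsC (c : K) : fps K := Fps (fun n => c *+ (n == 0)).
Definition fpsX : fps K := Fps (fun n => (n == 1)%:R).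

Definition fps_add p q : fps K := Fps (fun n => p n + q n).
Definition fps_opp p : fps K := Fps (fun n => - p n).
Definition fps_mul p q : fps K :=
  Fps (fun n => \sum_(i < n.+1) p i * q (n - i)%N).

Lemma fps_addA : associative fps_add.
Proof. by move=> p q r; apply: fps_eqP => n; apply: addrA. Qed.
Lemma fps_addC : commutative fps_add.
Proof. by move=> p q; apply: fps_eqP => n; apply: addrC. Qed.
Lemma fps_add0 : left_id (fpsC 0) fps_add.
Proof. by move=> p; apply: fps_eqP => n; rewrite /= mul0rn add0r. Qed.
Lemma fps_addN : left_inverse (fpsC 0) fps_opp fps_add.
Proof. by move=> p; apply: fps_eqP => n; rewrite /= mul0rn addNr. Qed.

HB.instance Definition _ :=
  GRing.isZmodule.Build (fps K) fps_addA fps_addC fps_add0 fps_addN.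

(* p is congruent to P modulo X^N *)
Definition fps_rep N p P := forall i, (i < N)%N -> p i = P`_i.

Lemma fps_rep_trunc N p : fps_rep N p (\poly_(i < N) p i).
Proof. by move=> i ltiN; rewrite coef_poly ltiN. Qed.

Lemma fps_rep_eq p q :
  (forall N, exists2 P, fps_rep N p P & fps_rep N q P) -> p = q.
Proof.
move=> eq_pq; apply: fps_eqP => n.
by have [P -> // ->] := eq_pq n.+1.
Qed.

Lemma fps_repC N c : fps_rep N (fpsC c) c%:P.
Proof. by move=> i _; rewrite coefC /=; case: eqP. Qed.

Lemma fps_repX N : fps_rep N fpsX 'X.
Proof. by move=> i _; rewrite coefX. Qed.

Lemma fps_repD N p q P Q :
  fps_rep N p P -> fps_rep N q Q -> fps_rep N (p + q) (P + Q).
Proof. by move=> pP qQ i iN; rewrite coefD -pP // -qQ. Qed.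

Lemma fps_repM_subproof N p q P Q :
  fps_rep N p P -> fps_rep N q Q -> fps_rep N (fps_mul p q) (P * Q).
Proof.
move=> pP qQ i iN; rewrite coefM /=; apply: eq_bigr => j _.
rewrite pP; last exact: leq_ltn_trans (leq_ord j) iN.
by rewrite qQ //; apply: leq_ltn_trans (leq_subr _ _) iN.
Qed.

Lemma fps_mulA : associative fps_mul.
Proof.
move=> p q r; apply: fps_rep_eq => N.
have [/= p' q' r'] :=
  And3 (@fps_rep_trunc N p) (@fps_rep_trunc N q) (@fps_rep_trunc N r).
eexists; first by apply: fps_repM_subproof p' (fps_repM_subproof q' r').
by rewrite mulrA; apply: fps_repM_subproof (fps_repM_subproof p' q') r'.
Qed.

Lemma fps_mulC : commutative fps_mul.
Proof.
move=> p q; apply: fps_rep_eq => N.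
have [p' q'] := (@fps_rep_trunc N p, @fps_rep_trunc N q).
eexists; first exact: fps_repM_subproof p' q'.
by rewrite mulrC; apply: fps_repM_subproof.
Qed.

Lemma fps_mul1 : left_id (fpsC 1) fps_mul.
Proof.
move=> p; apply: fps_rep_eq => N; have p' := @fps_rep_trunc N p.
exists (\poly_(i < N) p i) => //.
rewrite -[X in fps_rep _ _ X]mul1r.
by apply: fps_repM_subproof p'; apply: fps_repC.
Qed.

Lemma fps_mulDl : left_distributive fps_mul +%R.
Proof.
move=> p q r; apply: fps_eqP => n /=.
by rewrite -big_split; apply: eq_bigr => i _; rewrite mulrDl.
Qed.

Lemma fps_1neq0 : fpsC 1 != 0.
Proof.
by apply/eqP => /(congr1 (fun p : fps K => p 0%N)) /eqP; rewrite /= oner_eq0.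
Qed.

HB.instance Definition _ := GRing.Zmodule_isComNzRing.Build (fps K)
  fps_mulA fps_mulC fps_mul1 fps_mulDl fps_1neq0.

Lemma fps_repM N p q P Q :
  fps_rep N p P -> fps_rep N q Q -> fps_rep N (p * q) (P * Q).
Proof. exact: fps_repM_subproof. Qed.

Lemma fps_repXn N p P k : fps_rep N p P -> fps_rep N (p ^+ k) (P ^+ k).
Proof.
move=> pP; elim: k => [|k IHk]; first exact: fps_repC.
by rewrite !exprS; apply: fps_repM.
Qed.

Lemma fps_coef0M p q : (p * q) 0%N = p 0%N * q 0%N.
Proof. by rewrite [LHS]big_ord1. Qed.

Lemma fps_coef1M p q : (p * q) 1%N = p 0%N * q 1%N + p 1%N * q 0%N.
Proof. by rewrite [LHS]big_ord_recl big_ord1. Qed.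

Lemma fps_coefXn_lt f k n : f 0%N = 0 -> (n < k)%N -> (f ^+ k) n = 0.
Proof.
move=> f0; elim: k n => // k IHk n ltnk.
rewrite exprS [LHS]big_ord_recl f0 mul0r add0r big1 // => i _.
by rewrite IHk ?mulr0 // lift0; move: (ltn_ord i) ltnk; lia.
Qed.

Lemma fps_coefXn_diag f n : f 0%N = 0 -> (f ^+ n) n = f 1%N ^+ n.
Proof.
move=> f0; elim: n => [|n IHn]; first by [].
rewrite !exprS [LHS]big_ord_recl f0 mul0r add0r big_ord_recl lift0.
rewrite subSS subn0 IHn big1 ?addr0 // => i _.
by rewrite fps_coefXn_lt ?mulr0 // !lift0; move: (ltn_ord i); lia.
Qed.

Section Triangular.
Variables (A : nat -> nat -> K) (b : nat -> K).

Fixpoint tri_prefix n : seq K :=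
  if n is m.+1 then
    let s := tri_prefix m in
    rcons s ((b m - \sum_(k < m) s`_k * A m k) / A m m)
  else [::].

Definition tri_solve : fps K := Fps (fun n => (tri_prefix n.+1)`_n).

Lemma size_tri_prefix n : size (tri_prefix n) = n.
Proof. by elim: n => //= n IHn; rewrite size_rcons IHn. Qed.

Lemma tri_prefixE n k : (k < n)%N -> (tri_prefix n)`_k = tri_solve k.
Proof.
elim: n => // n IHn; rewrite ltnS leq_eqVlt => /predU1P[-> //|ltkn].
by rewrite -IHn //= nth_rcons size_tri_prefix ltkn.
Qed.

Lemma tri_solveP n : A n n != 0 ->
  \sum_(k < n.+1) tri_solve k * A n k = b n.
Proof.
move=> Annz; rewrite big_ord_recr.
have -> : tri_solve n = (b n - \sum_(k < n) tri_solve k * A n k) / A n n.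
  rewrite {1}/tri_solve /= nth_rcons size_tri_prefix ltnn eqxx.
  by under eq_bigr do rewrite tri_prefixE //.
by rewrite divfK //= addrC subrK.
Qed.
End Triangular.

Definition fps_unit : {pred fps K} := [pred p : fps K | p 0%N != 0].
Definition fps_inv p : fps K :=
  if p \in fps_unit then
    tri_solve (fun n k => p (n - k)%N) (fun n => (1 : fps K) n)
  else p.

Lemma fps_mulVp : {in fps_unit, left_inverse 1 fps_inv *%R}.
Proof.
move=> p p_unit; apply: fps_eqP => n; rewrite /fps_inv p_unit.
by apply: tri_solveP; rewrite subnn.
Qed.

Lemma fps_unitP p q : q * p = 1 -> p \in fps_unit.
Proof.
move=> /(congr1 (fun p : fps K => p 0%N)); rewrite fps_coef0M inE /= => qp1.
apply/eqP => p0; move: qp1; rewrite p0 mulr0 => /esym/eqP.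
by rewrite [_ == _]oner_eq0.
Qed.

Lemma fps_inv_out : {in [predC fps_unit], fps_inv =1 id}.
Proof. by move=> p /negbTE; rewrite /fps_inv -topredE /= => ->. Qed.

HB.instance Definition _ := GRing.ComNzRing_hasMulInverse.Build (fps K)
  fps_mulVp fps_unitP fps_inv_out.

(* g(f(t)); since [t^n] f(t)^k = 0 for k > n when f(0) = 0, truncating the sum
   at k = n loses nothing. It is only meaningful for f(0) = 0. *)
Definition fps_comp g f : fps K :=
  Fps (fun n => \sum_(k < n.+1) g k * (f ^+ k) n).

Lemma fps_rep_comp N g f G F : f 0%N = 0 ->
  fps_rep N g G -> fps_rep N f F -> fps_rep N (fps_comp g f) (G \Po F).
Proof.
move=> f0 gG fF i ltiN; rewrite coef_comp_poly /=.
have gf0 k : (i < k)%N -> (F ^+ k)`_i = 0.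
  by move=> ltik; rewrite -(fps_repXn k fF ltiN) fps_coefXn_lt.
set m := maxn i.+1 (size G).
rewrite (big_ord_widen m (fun k => g k * (f ^+ k) i)) ?leq_maxl //.
rewrite [RHS](big_ord_widen m (fun k => G`_k * (F ^+ k)`_i)) ?leq_maxr //.
rewrite big_mkcond [RHS]big_mkcond; apply: eq_bigr => k _ /=.
case: ltnP => [leki|ltik]; last by case: ifP => // _; rewrite gf0 ?mulr0.
rewrite gG; last exact: leq_trans leki ltiN.
rewrite (fps_repXn k fF ltiN).
by case: ltnP => // /leq_sizeP -> //; rewrite mul0r.
Qed.

Lemma fps_comp_coef0 g f : (fps_comp g f) 0%N = g 0%N.
Proof. by rewrite /= big_ord1 mulr1. Qed.

Lemma fps_comp_coef1 g f : (fps_comp g f) 1%N = g 1%N * f 1%N.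
Proof. by rewrite /= big_ord_recl big_ord1 /= mulr0 add0r expr1. Qed.

Lemma fps_comp1 f : fps_comp 1 f = 1.
Proof.
apply: fps_eqP => n; rewrite /= big_ord_recl big1 ?addr0 /= ?mul1r // => i _.
by rewrite mul0r.
Qed.

Lemma fps_compXl f : f 0%N = 0 -> fps_comp fpsX f = f.
Proof.
move=> f0; apply: fps_rep_eq => N; have f' := @fps_rep_trunc N f.
exists (\poly_(i < N) f i) => //; rewrite -[X in fps_rep _ _ X]comp_polyX.
by apply: fps_rep_comp f' => //; apply: fps_repX.
Qed.

Lemma fps_compXr g : fps_comp g fpsX = g.
Proof.
apply: fps_rep_eq => N; have g' := @fps_rep_trunc N g.
exists (\poly_(i < N) g i) => //; rewrite -[X in fps_rep _ _ X]comp_polyXr.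
by apply: fps_rep_comp g' _ => //; apply: fps_repX.
Qed.

Lemma fps_compM g h f : f 0%N = 0 ->
  fps_comp (g * h) f = fps_comp g f * fps_comp h f.
Proof.
move=> f0; apply: fps_rep_eq => N.
have [g' h' f'] :=
  And3 (@fps_rep_trunc N g) (@fps_rep_trunc N h) (@fps_rep_trunc N f).
eexists; first exact: fps_rep_comp f0 (fps_repM g' h') f'.
by rewrite comp_polyM; apply: fps_repM; apply: fps_rep_comp.
Qed.

Lemma fps_compA h g f : g 0%N = 0 -> f 0%N = 0 ->
  fps_comp h (fps_comp g f) = fps_comp (fps_comp h g) f.
Proof.
move=> g0 f0; apply: fps_rep_eq => N.
have [h' g' f'] :=
  And3 (@fps_rep_trunc N h) (@fps_rep_trunc N g) (@fps_rep_trunc N f).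
have gf0: fps_comp g f 0%N = 0 by rewrite fps_comp_coef0.
eexists; first exact: fps_rep_comp gf0 h' (fps_rep_comp f0 g' f').
by rewrite comp_polyA; apply: fps_rep_comp f0 (fps_rep_comp g0 h' g') f'.
Qed.

(* h(f(t)) = p(t) is solved for h; used to invert f(t) under composition. *)
Lemma fps_comp_solve f p : f 0%N = 0 -> f 1%N != 0 ->
  fps_comp (tri_solve (fun n k => (f ^+ k) n) p) f = p.
Proof.
move=> f0 f1; apply: fps_eqP => n; apply: tri_solveP.
by rewrite fps_coefXn_diag // expf_neq0.
Qed.

End FpsRing.

Arguments fpsX {K}.

Section RiordanGroup.
Variable K : fieldType.

Definition is_riordan (u : fps K * fps K) : bool :=
  [&& u.1 0%N != 0, u.2 0%N == 0 & u.2 1%N != 0].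

Record riordan := Riordan {
  riordan_pair :> fps K * fps K;
  _ : is_riordan riordan_pair }.

HB.instance Definition _ := [isSub for riordan_pair].
HB.instance Definition _ := [Choice of riordan by <:].

Implicit Types r : riordan.

Lemma riordanP r : [/\ r.1 0%N != 0, r.2 0%N = 0 & r.2 1%N != 0].
Proof. by case/and3P: (valP r) => ? /eqP. Qed.

Definition riordan_pair_mul (u v : fps K * fps K) : fps K * fps K :=
  (u.1 * fps_comp v.1 u.2, fps_comp v.2 u.2).

Fact riordan_mul_subproof r1 r2 : is_riordan (riordan_pair_mul r1 r2).
Proof.
have [[a0 f0 f1] [b0 g0 g1]] := (riordanP r1, riordanP r2).
rewrite /is_riordan fps_coef0M fps_comp_coef1 !fps_comp_coef0.
by rewrite g0 eqxx !mulf_neq0.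
Qed.

Fact riordan_one_subproof : is_riordan (1, fpsX).
Proof. by rewrite /is_riordan /= eqxx !oner_eq0. Qed.

Definition riordan_mul r1 r2 := Riordan (riordan_mul_subproof r1 r2).
Definition riordan_one := Riordan riordan_one_subproof.

Lemma riordan_mulA : associative riordan_mul.
Proof.
move=> r1 r2 r3; apply: val_inj; rewrite /= /riordan_pair_mul /=.
have [[_ f0 _] [_ g0 _]] := (riordanP r1, riordanP r2).
by rewrite fps_compM // !fps_compA // mulrA.
Qed.

Lemma riordan_mul1 : left_id riordan_one riordan_mul.
Proof.
move=> r; apply: val_inj; rewrite /= /riordan_pair_mul /= !fps_compXr mul1r.
by rewrite -surjective_pairing.
Qed.

Lemma riordan_mulr1 : right_id riordan_one riordan_mul.
Proof.
move=> r; apply: val_inj; rewrite /= /riordan_pair_mul /=.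
case: (riordanP r) => _ f0 _.
by rewrite fps_comp1 mulr1 fps_compXl // -surjective_pairing.
Qed.

Definition riordan_pair_inv (u : fps K * fps K) : fps K * fps K :=
  let solve p := tri_solve (fun n k => (u.2 ^+ k) n) (fps_coef p) in
  (solve (u.1^-1), solve fpsX).

Lemma riordan_pair_mulV r :
  riordan_pair_mul r (riordan_pair_inv r) = (1, fpsX).
Proof.
case: (riordanP r) => a0 f0 f1.
congr pair; last exact: fps_comp_solve.
by rewrite [fps_comp _ _]fps_comp_solve // mulrV.
Qed.

Fact riordan_inv_subproof r : is_riordan (riordan_pair_inv r).
Proof.
have e := riordan_pair_mulV r.
have [mul1 mul2] := (congr1 fst e, congr1 snd e).
case: (riordanP r) => a0 f0 f1.
have := congr1 (fun p : fps K => p 0%N) mul1.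
have := congr1 (fun p : fps K => p 0%N) mul2.
have := congr1 (fun p : fps K => p 1%N) mul2.
rewrite fps_coef0M !fps_comp_coef0 fps_comp_coef1 => e1 e2 e3.
apply/and3P; split.
- apply/eqP => z; move: e3; rewrite z mulr0 => /esym/eqP.
  by rewrite [_ == _]oner_eq0.
- by rewrite e2.
- apply/eqP => z; move: e1; rewrite z mul0r => /esym/eqP.
  by rewrite [_ == _]oner_eq0.
Qed.

Definition riordan_inv r := Riordan (riordan_inv_subproof r).

Lemma riordan_mulrV : right_inverse riordan_one riordan_inv riordan_mul.
Proof. by move=> r; apply: val_inj; apply: riordan_pair_mulV. Qed.

Lemma riordan_mulVr : left_inverse riordan_one riordan_inv riordan_mul.
Proof.
move=> r; rewrite -[LHS]riordan_mulr1 -(riordan_mulrV (riordan_inv r)).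
rewrite riordan_mulA -(riordan_mulA (riordan_inv r)) riordan_mulrV.
by rewrite riordan_mulr1.
Qed.

HB.instance Definition _ := isGroup.Build riordan
  riordan_mulA riordan_mul1 riordan_mulr1 riordan_mulVr riordan_mulrV.

Definition riordan_mx r (n k : nat) : K := (r.1 * r.2 ^+ k) n.

Lemma riordan_mx2E r :
  [/\ riordan_mx r 0 0 = r.1 0%N, riordan_mx r 0 1 = 0,
      riordan_mx r 1 0 = r.1 1%N & riordan_mx r 1 1 = r.1 0%N * r.2 1%N].
Proof.
case: (riordanP r) => _ f0 _.
rewrite /riordan_mx expr0 expr1 mulr1; split=> //.
- by rewrite fps_coef0M f0 mulr0.
- by rewrite fps_coef1M f0 mulr0 addr0.
Qed.

End RiordanGroup.

Section Pi2.
Variable K : finFieldType.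
Implicit Types r : riordan K.

Definition riordan_mx2 r : 'M[K]_2 := \matrix_(i, j) riordan_mx r i j.

Fact riordan_mx2_unit r : riordan_mx2 r \is a GRing.unit.
Proof.
case: (riordanP r) => a0 f0 f1.
rewrite [_ \is a _]unitmxE unitfE det_trig.
  by rewrite !big_ord_recl big_ord0 !mxE /riordan_mx !(expr0, expr1, mulr1)
    fps_coef1M f0 mulr0 addr0 !mulf_neq0.
apply/is_trig_mxP => -[[|[|//]] ?] [[|[|//]] ?] //= _.
by rewrite mxE /riordan_mx fps_coef0M f0 mulr0.
Qed.

Definition pi2 r : {'GL_2[K]} := FinRing.unit 'M[K]_2 (riordan_mx2_unit r).

Fact pi2_multiplicative : {morph pi2 : r1 r2 / (r1 * r2)%g}.
Proof.
move=> r1 r2; apply: val_inj; apply/matrixP => i j.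
have [[p00 p01 p10 p11] [q00 q01 q10 q11]] := (riordan_mx2E r1, riordan_mx2E r2).
have [m00 m01 m10 m11] := riordan_mx2E (r1 * r2)%g.
have e1 : (r1 * r2)%g.1 = r1.1 * fps_comp r2.1 r1.2 by [].
have e2 : (r1 * r2)%g.2 = fps_comp r2.2 r1.2 by [].
have coefE := (fps_coef0M, fps_coef1M, fps_comp_coef0, fps_comp_coef1).
rewrite !mxE !big_ord_recl big_ord0 !mxE addr0.
case: i j => [] [|[|//]] lti [] [|[|//]] ltj;
  rewrite ?(m00, m01, m10, m11, p00, p01, p10, p11, q00, q01, q10, q11);
  rewrite ?(e1, e2, coefE, mulr0, mul0r, addr0, add0r) //.
  by rewrite addrC (mulrC (r2.1 1%N)) mulrA.
by rewrite (mulrC (r2.2 1%N)) mulrACA.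
Qed.

HB.instance Definition _ := isMultiplicative.Build (riordan K) {'GL_2[K]}
  pi2 pi2_multiplicative.
End Pi2.

Section S3.

(* (1 2) and (1 3) with the points 1, 2, 3 renamed 0, 1, 2. *)
Definition sigma1 : 'S_3 := tperm 0 1.
Definition sigma2 : 'S_3 := tperm 0 2.

Definition riordan_gen (a c : 'F_3) (s : nat) : fps 'F_3 * fps 'F_3 :=
  (fpsC a / (1 + fpsC c * fpsX) ^+ s, fpsC 2 * fpsX / (1 + fpsC c * fpsX)).

Definition riordan_r1 (a b : 'F_3) (s : nat) := riordan_gen a (b + 1) s.
Definition riordan_r2 (a b : 'F_3) (s : nat) := riordan_gen a b s.

(* As sigma1 and sigma2 generate 'S_3, each of the two conditions below is
   satisfied by at most one morphism. *)
Definition is_rho (a b : 'F_3) (s : nat)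
    (rho : {multiplicative 'S_3 -> riordan 'F_3}) : Prop :=
  riordan_pair (rho sigma1) = riordan_r2 a b s /\
  riordan_pair (rho sigma2) = riordan_r1 a b s.

Definition mx2 (a b c d : 'F_3) : 'M['F_3]_2 :=
  \matrix_(i, j) if i == 0 then if j == 0 then a else b
                 else if j == 0 then c else d.

Definition is_B (B : {multiplicative 'S_3 -> {'GL_2['F_3]}}) : Prop :=
  GLval (B sigma1) = mx2 2 2 0 1 /\ GLval (B sigma2) = mx2 1 0 2 2.

(* The two matrices are those of the action of the permutation matrices on the
   plane x1 + x2 + x3 = 0, in the basis (e1 - e2, e1 - e3). *)
Definition sum0_basis : 'M['F_3]_(3, 2) :=
  \matrix_(i, j) if i == 0 then 1 else - (i == j.+1 :> nat)%:R.

Lemma perm_mx_sigma1 :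
  perm_mx sigma1 *m sum0_basis = sum0_basis *m mx2 2 2 0 1.
Proof.
rewrite -row_permE; apply/matrixP => i j; rewrite !mxE.
rewrite !big_ord_recl big_ord0 !mxE /sigma1 permE.
case: i j => [] [|[|[|//]]] lti [] [|[|//]] ltj; exact/eqP.
Qed.

Lemma perm_mx_sigma2 :
  perm_mx sigma2 *m sum0_basis = sum0_basis *m mx2 1 0 2 2.
Proof.
rewrite -row_permE; apply/matrixP => i j; rewrite !mxE.
rewrite !big_ord_recl big_ord0 !mxE /sigma2 permE.
case: i j => [] [|[|[|//]]] lti [] [|[|//]] ltj; exact/eqP.
Qed.

Definition equivalent_repr (G : groupType)
    (phi psi : {multiplicative G -> {'GL_2['F_3]}}) : Prop :=
  exists T : {'GL_2['F_3]}, forall g : G, phi g = (T * psi g * T^-1)%g.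

End S3.

(* Main.v *)
(* S_3 is presented by two involutions subject to the braid relation, so B and
   rho exist as soon as these relations are checked on the images of the two
   transpositions; over F_3 the second series in r_1 is - t / (1 + t), and the
   braid relation reduces to t + t = - t. For the equivalence it suffices to
   intertwine the generators: the columns of T are eigenvectors of B(sigma_1)
   for 2 and 1, scaled so as to be compatible with sigma_2. *)
From HB Require Import structures.
Require Import Defs.
From mathcomp Require Import all_boot all_order all_algebra all_fingroup.
From mathcomp Require Import ring.

Set Implicit Arguments.
Unset Strict Implicit.
Unset Printing Implicit Defensive.

Import GRing.Theory.
Local Open Scope ring_scope.

(** * Generation of S_3 by [sigma1] and [sigma2] *)

Lemma sigma_ind (P : 'S_3 -> Prop) :
  P 1%g -> (forall s, P s -> P (sigma1 * s)%g) ->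
  (forall s, P s -> P (sigma2 * s)%g) -> forall s, P s.
Proof.
move=> P1 Px Py s.
have : s \in <<[set tperm 0 y | y in 'I_3]>>%g by rewrite gen_tperm inE.
case/gen_prodgP => n [c cP ->].
elim: n c cP => [|n IHn] c cP; first by rewrite big_ord0.
rewrite big_ord_recl; have IH := IHn _ (fun i => cP (lift ord0 i)).
(* The generating set also contains [tperm 0 0], which is the identity. *)
have /imsetP[[[|[|[|//]]] lti] _ ->] := cP ord0.
- by rewrite (_ : Ordinal lti = 0) ?tperm1 ?mul1g //; apply: val_inj.
- by rewrite (_ : Ordinal lti = 1); [apply: Px | apply: val_inj].
- by rewrite (_ : Ordinal lti = 2); [apply: Py | apply: val_inj].
Qed.

(** * The presentation of S_3, with (xy)^3 = 1 in its braid form *)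

Section Presentation.
Variables (G : groupType) (x y : G).
Hypotheses (xx : (x * x = 1)%g) (yy : (y * y = 1)%g).
Hypothesis xyx : (x * y * x = y * x * y)%g.

(* The element of G attached to the permutation mapping 0 to i and 1 to j; junk
   if i = j. *)
Definition word3 (i j : 'I_3) : G :=
  match val i, val j with
  | 0, 1 => 1
  | 1, 0 => x
  | 2, 1 => y
  | 1, _ => x * y
  | 2, _ => y * x
  | _, _ => x * y * x
  end%g.

Definition S3_lift (s : 'S_3) : G := word3 (s 0) (s 1).

(** Here [i], [j], [k] stand for the images of 0, 1, 2. Products in ['S_3] apply the left factor
    first, so left multiplication by a transposition permutes these images. *)
Lemma word3_swap (i j k : 'I_3) : i != j -> i != k -> j != k ->
  word3 j i = (x * word3 i j)%g /\ word3 k j = (y * word3 i j)%g.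
Proof.
have xK z : (x * (x * z) = z)%g by rewrite mulgA xx mul1g.
have yK z : (y * (y * z) = z)%g by rewrite mulgA yy mul1g.
have xyxE : (y * (x * y) = x * (y * x))%g by rewrite !mulgA.
(* The braid word is first written with [x] in front, to cancel [x], then with [y] in front, to
   cancel [y]. *)
case: i j k => [[|[|[|//]]] ?] [[|[|[|//]]] ?] [[|[|[|//]]] ?] //= _ _ _;
  by rewrite /word3 /= -?mulgA ?xyxE ?xK -?xyxE ?yK ?xx ?yy ?mulg1.
Qed.

Lemma S3_lift_gen s :
  S3_lift (sigma1 * s)%g = (x * S3_lift s)%g /\
  S3_lift (sigma2 * s)%g = (y * S3_lift s)%g.
Proof.
rewrite /S3_lift !permM.
have -> : sigma1 0 = 1 by rewrite /sigma1 tpermL.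
have -> : sigma1 1 = 0 by rewrite /sigma1 tpermR.
have -> : sigma2 0 = 2 by rewrite /sigma2 tpermL.
have -> : sigma2 1 = 1 by rewrite /sigma2 tpermD.
by apply: word3_swap; rewrite (inj_eq perm_inj).
Qed.

Lemma S3_lift1 : S3_lift 1%g = 1%g.
Proof. by rewrite /S3_lift !perm1. Qed.

Lemma S3_liftM : {morph S3_lift : s t / (s * t)%g}.
Proof.
move=> s t; elim/sigma_ind: s => [|s IHs|s IHs].
- by rewrite S3_lift1 !mul1g.
- by rewrite -mulgA (S3_lift_gen (s * t)%g).1 IHs (S3_lift_gen s).1 mulgA.
- by rewrite -mulgA (S3_lift_gen (s * t)%g).2 IHs (S3_lift_gen s).2 mulgA.
Qed.

HB.instance Definition _ :=
  isMultiplicative.Build 'S_3 G S3_lift S3_liftM.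

Lemma S3_presentation :
  exists f : {multiplicative 'S_3 -> G}, f sigma1 = x /\ f sigma2 = y.
Proof.
exists S3_lift; have [] := S3_lift_gen 1%g.
by rewrite !mulg1 S3_lift1 !mulg1.
Qed.

End Presentation.

(** * Inversion and composition of power series *)

Section FpsComp.
Variable K : fieldType.
Implicit Types (p q f : fps K) (a : K).

Lemma fps_unitE p : (p \is a GRing.unit) = (p 0%N != 0).
Proof. by []. Qed.

Lemma fps_coef0V p : p 0%N != 0 -> p^-1 0%N = (p 0%N)^-1.
Proof.
move=> p0; apply: (mulfI p0); rewrite -fps_coef0M divff //.
by rewrite divrr.
Qed.

(** The coefficient of t in p / p = 1 vanishes. *)
Lemma fps_coef1V p : p 0%N != 0 -> p^-1 1%N = - p 1%N / p 0%N ^+ 2.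
Proof.
move=> p0; apply: (mulfI p0).
have : (p / p) 1%N = 0 by rewrite divrr.
rewrite fps_coef1M fps_coef0V // => /eqP; rewrite addr_eq0 => /eqP ->.
by field.
Qed.

Lemma fps_compD p q f : fps_comp (p + q) f = fps_comp p f + fps_comp q f.
Proof.
by apply: fps_eqP => n /=; rewrite -big_split; apply: eq_bigr => i _; rewrite mulrDl.
Qed.

Lemma fps_compN p f : fps_comp (- p) f = - fps_comp p f.
Proof.
by apply: fps_eqP => n /=; rewrite -sumrN; apply: eq_bigr => i _; rewrite mulNr.
Qed.

Lemma fps_compV p f : f 0%N = 0 -> p 0%N != 0 ->
  fps_comp p^-1 f = (fps_comp p f)^-1.
Proof.
move=> f0 p0.
have pf_unit : fps_comp p f \is a GRing.unit by rewrite fps_unitE fps_comp_coef0.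
apply: (mulrI pf_unit); rewrite -fps_compM // !divrr //.
exact: fps_comp1.
Qed.

End FpsComp.

(** Unfolds only the outer product, so that an inner product can be replaced by its known value. *)
Lemma riordan_pairM (K : fieldType) (r1 r2 : riordan K) :
  riordan_pair (r1 * r2)%g = riordan_pair_mul r1 r2.
Proof. by []. Qed.

(** * The elements r_1 and r_2 for (a, b, s) = (2, 0, 1), written with 2 = -1 *)

Section Riordan3.

Let X : fps 'F_3 := fpsX.
Let u : fps 'F_3 := (1 + X)^-1.

Lemma fpsC2 : fpsC 2 = -1 :> fps 'F_3.
Proof. by apply: fps_eqP => -[|n] /=; apply/eqP. Qed.

Lemma riordan_r1E : riordan_r1 2 0 1 = (- u, - (X * u)).
Proof. by rewrite /riordan_r1 /riordan_gen add0r fpsC2 mul1r expr1 !mulN1r mulNr. Qed.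

Lemma riordan_r2E : riordan_r2 2 0 1 = (-1, - X).
Proof.
have fpsC0 : fpsC 0 = 0 :> fps 'F_3 by [].
by rewrite /riordan_r2 /riordan_gen fpsC2 fpsC0 mul0r addr0 expr1 !divr1 mulN1r.
Qed.

Let onePX0 : (1 + X) 0%N = 1.
Proof. exact/eqP. Qed.

Let onePX1 : (1 + X) 1%N = 1.
Proof. exact/eqP. Qed.

Let u0 : u 0%N = 1.
Proof. by rewrite fps_coef0V onePX0 ?invr1. Qed.

Let u1 : u 1%N = -1.
Proof. by rewrite fps_coef1V onePX0 ?onePX1 // expr1n divr1. Qed.

Let compU (f : fps 'F_3) : f 0%N = 0 -> fps_comp u f = (1 + f)^-1.
Proof.
by move=> f0; rewrite fps_compV ?onePX0 // fps_compD fps_comp1 fps_compXl.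
Qed.

Let r1_coef :
  [/\ (- u) 0%N = -1, (- u) 1%N = 1,
      (- (X * u)) 0%N = 0 & (- (X * u)) 1%N = -1].
Proof.
have oppE (p : fps 'F_3) n : (- p) n = - p n by [].
by rewrite !oppE fps_coef0M fps_coef1M u0 u1; split; apply/eqP.
Qed.

Fact is_riordan_r1 : is_riordan (riordan_r1 2 0 1).
Proof.
by rewrite riordan_r1E /is_riordan; case: r1_coef => /= -> _ -> ->.
Qed.

Fact is_riordan_r2 : is_riordan (riordan_r2 2 0 1).
Proof. by rewrite riordan_r2E. Qed.

Definition rho_r1 := Riordan is_riordan_r1.
Definition rho_r2 := Riordan is_riordan_r2.

Let u_unit : (1 + X) \is a GRing.unit.
Proof. by rewrite fps_unitE onePX0. Qed.

Lemma rho_r2_sqr : (rho_r2 * rho_r2 = 1)%g.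
Proof.
apply: val_inj; rewrite /= riordan_r2E /riordan_pair_mul /=.
have X0 : (- X) 0%N = 0 by apply/eqP.
by rewrite !fps_compN fps_comp1 fps_compXl // mulrNN mulr1 opprK.
Qed.

Lemma rho_r1_sqr : (rho_r1 * rho_r1 = 1)%g.
Proof.
apply: val_inj; rewrite /= riordan_r1E /riordan_pair_mul /=.
have [_ _ f0 _] := r1_coef.
(* With f = - X u the second series of r_1, this reads 1 + f = u; hence u(f) = 1 / (1 + f) = 1 +
   X. *)
have uE : 1 - X * u = u.
  by apply: (mulIr u_unit); rewrite mulrBl mul1r -mulrA mulVr // mulr1 addrK.
rewrite !fps_compN fps_compM // fps_compXl // compU // uE invrK.
by rewrite mulrNN mulNr opprK -mulrA !mulVr // mulr1.
Qed.

Lemma rho_braid : (rho_r2 * rho_r1 * rho_r2 = rho_r1 * rho_r2 * rho_r1)%g.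
Proof.
have e12 : riordan_pair (rho_r1 * rho_r2)%g = (u, X * u).
  rewrite /= riordan_r1E riordan_r2E /riordan_pair_mul /=.
  have [_ _ f0 _] := r1_coef.
  by rewrite !fps_compN fps_comp1 fps_compXl // mulrN1 !opprK.
(* Only the left side is reassociated: [rho_r1 * rho_r2] then occurs on both sides. *)
rewrite -mulgA; apply: (val_inj : injective (@riordan_pair _)).
rewrite [LHS]riordan_pairM [RHS]riordan_pairM e12 /= riordan_r1E riordan_r2E.
rewrite /riordan_pair_mul /=.
have X0 : (- X) 0%N = 0 by apply/eqP.
have Xu0 : (X * u) 0%N = 0 by rewrite fps_coef0M mul0r.
rewrite !fps_compN !fps_compM // !fps_compXl // !compU //.
have Xu1 : (1 + X * u) 0%N = 1 by rewrite -[LHS]/(1 + (X * u) 0%N) Xu0 addr0.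
have X3 : X + X = - X by apply: fps_eqP => -[|[|n]]; apply/eqP.
(* Indeed (1 + X u)(1 + X) = 1 + X + X, which is 1 - X by [X3]. *)
have uM : u / (1 + X * u) = (1 - X)^-1.
  rewrite -invrM ?u_unit ?fps_unitE ?Xu1 //.
  by rewrite mulrDl mul1r -mulrA mulVr // mulr1 -addrA X3.
by rewrite -[X * u / _]mulrA mulrN uM mulN1r mulNr.
Qed.

(* The lower left entry is [t^1] 2 / (1 + t) = - 2 = 1, where the paper prints 2. *)
Lemma pi2_rho_r1 : GLval (pi2 rho_r1) = mx2 2 0 1 1.
Proof.
have [e00 e01 e10 e11] := riordan_mx2E rho_r1.
have [c0 c1 _ d1] := r1_coef.
rewrite (riordan_r1E : riordan_pair rho_r1 = _) ?(c0, c1, d1) in e00 e10 e11.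
apply/matrixP => i j; rewrite !mxE.
by case: i j => [[|[|//]] ?] [[|[|//]] ?];
  rewrite /= ?(e00, e01, e10, e11); apply/eqP.
Qed.

Lemma pi2_rho_r2 : GLval (pi2 rho_r2) = mx2 2 0 0 1.
Proof.
have [e00 e01 e10 e11] := riordan_mx2E rho_r2.
rewrite (riordan_r2E : riordan_pair rho_r2 = _) in e00 e10 e11.
apply/matrixP => i j; rewrite !mxE.
by case: i j => [[|[|//]] ?] [[|[|//]] ?];
  rewrite /= ?(e00, e01, e10, e11); apply/eqP.
Qed.

End Riordan3.

(** * Two-by-two matrices over F_3, and equivalence tested on generators *)

Lemma mx2_unit a b c d : a * d - b * c != 0 -> mx2 a b c d \is a GRing.unit.
Proof.
rewrite [_ \is a _]unitmxE unitfE (expand_det_row _ 0) !big_ord_recl big_ord0.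
by rewrite /cofactor !det_mx11 !mxE /= addr0 expr0 expr1 mul1r mulN1r mulrN.
Qed.

Lemma mulmx2 a b c d a' b' c' d' :
  mx2 a b c d * mx2 a' b' c' d' =
  mx2 (a * a' + b * c') (a * b' + b * d') (c * a' + d * c') (c * b' + d * d').
Proof.
apply/matrixP => i j; rewrite !mxE !big_ord_recl big_ord0 !mxE addr0.
by case: i j => [[|[|//]] ?] [[|[|//]] ?].
Qed.

Lemma mx2_1 : mx2 1 0 0 1 = 1.
Proof.
by apply/matrixP => i j; rewrite !mxE; case: i j => [[|[|//]] ?] [[|[|//]] ?].
Qed.

Lemma multiplicative1 (G H : groupType) (f : {multiplicative G -> H}) :
  f 1%g = 1%g.
Proof. by apply: (mulgI (f 1%g)); rewrite -gmulfM !mulg1. Qed.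

(** The relation [phi g * T = T * psi g] passes to products, so [sigma_ind] extends it from the
    generators to all of S_3. *)
Lemma equivalent_on_gens (phi psi : {multiplicative 'S_3 -> {'GL_2['F_3]}})
    (T : {'GL_2['F_3]}) :
  (phi sigma1 * T = T * psi sigma1)%g -> (phi sigma2 * T = T * psi sigma2)%g ->
  equivalent_repr phi psi.
Proof.
move=> T1 T2; exists T => g; rewrite -[LHS](mulgK T); congr (_ * _)%g.
elim/sigma_ind: g => [|s IHs|s IHs].
- by rewrite !multiplicative1 mul1g mulg1.
- by rewrite !gmulfM -mulgA IHs !mulgA T1.
- by rewrite !gmulfM -mulgA IHs !mulgA T2.
Qed.

Theorem corollary10 :
  (exists B : {multiplicative 'S_3 -> {'GL_2['F_3]}}, is_B B) /\
  (exists rho : {multiplicative 'S_3 -> riordan 'F_3}, is_rho 2 0 1 rho) /\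
  (forall (B : {multiplicative 'S_3 -> {'GL_2['F_3]}})
          (rho : {multiplicative 'S_3 -> riordan 'F_3}),
      is_B B -> is_rho 2 0 1 rho ->
      equivalent_repr B (@pi2 'F_3 \o rho)).
Proof.
split; [|split].
- have unit1 : mx2 2 2 0 1 \is a GRing.unit by apply: mx2_unit.
  have unit2 : mx2 1 0 2 2 \is a GRing.unit by apply: mx2_unit.
  have [||| B [B1 B2]] := @S3_presentation {'GL_2['F_3]}
    (FinRing.unit _ unit1) (FinRing.unit _ unit2).
  + by apply: val_inj; rewrite /= mulmx2 -mx2_1; congr mx2; apply/eqP.
  + by apply: val_inj; rewrite /= mulmx2 -mx2_1; congr mx2; apply/eqP.
  + by apply: val_inj; rewrite /= !mulmx2; congr mx2; apply/eqP.
  by exists B; split; rewrite ?B1 ?B2.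
- have [rho [rho1 rho2]] := S3_presentation rho_r2_sqr rho_r1_sqr rho_braid.
  by exists rho; split; rewrite ?rho1 ?rho2.
move=> B rho [B1 B2] [rho1 rho2].
have {rho1} rho1 : rho sigma1 = rho_r2 by apply: val_inj.
have {rho2} rho2 : rho sigma2 = rho_r1 by apply: val_inj.
(* The column v2 = (2,2) is e1 + e2 + e3 in the basis [sum0_basis], fixed by both generators. The
   column v1 = (1,0) satisfies B(sigma_1) v1 = 2 v1 and B(sigma_2) v1 = 2 v1 + v2, which determines
   the relative scaling. *)
have unitT : mx2 1 2 0 2 \is a GRing.unit by apply: mx2_unit.
pose T : {'GL_2['F_3]} := FinRing.unit _ unitT.
have GLval_inj : injective (@GLval 2 'F_3) by apply: val_inj.
have BT1 : (B sigma1 * T = T * pi2 (rho sigma1))%g.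
  apply: GLval_inj; rewrite rho1 !GL_ME B1 pi2_rho_r2 !mulmx2.
  by congr mx2; apply/eqP.
have BT2 : (B sigma2 * T = T * pi2 (rho sigma2))%g.
  apply: GLval_inj; rewrite rho2 !GL_ME B2 pi2_rho_r1 !mulmx2.
  by congr mx2; apply/eqP.
by apply: (@equivalent_on_gens B (@pi2 'F_3 \o rho) T).
Qed.
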